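(* Let $\beta$, $\rho_\pm>0$, $u_\pm\ge 0$ be constants with $u_+<u_-$, and set $A_0=\rho_-(u_--u_+)$. For each fixed $A$ with $0<A<A_0$ one has $(\rho_+,u_+)\in \mathrm{III}$, where $\mathrm{III}=\{(\rho,v): v\le u_--\frac{A}{\rho_-}\}$. For such $A$, let $(\rho,u)$ be the delta shock wave solution (given in the context) of the Riemann problem for the Chaplygin pressure Aw–Rascle model with Coulomb-like friction $$\rho_t+(\rho u)_x=0,\qquad (\rho(u+P))_t+(\rho u(u+P))_x=\beta\rho,\qquad P=-\frac{A}{\rho},$$ with initial data $(\rho,u)(x,0)=(\rho_-,u_-)$ for $x<0$ and $(\rho,u)(x,0)=(\rho_+,u_+)$ for $x>0$. Then, when $A\to0$, $(\rho,u)$ converges to a delta shock wave solution (given in the context) of the transportation equations with the same source term $$\rho_t+(\rho u)_x=0,\qquad (\rho u)_t+(\rho u^2)_x=\beta\rho$$ and the same initial data.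
   Context: All delta shock wave solutions here have the form $$(\rho,u)(x,t)=\begin{cases}(\rho_-,u_-+\beta t), & x<x(t),\\ (w(t)\delta(x-x(t)),\,u_\delta(t)), & x=x(t),\\ (\rho_+,u_++\beta t), & x>x(t),\end{cases}$$ where $x(t)$ is the position, $w(t)$ the strength and $\sigma(t)=x'(t)=u_\delta(t)$ the propagation speed of the delta shock. That is, $\rho$ carries on the curve $x=x(t)$ a Dirac measure of weight $w(t)$, acting on test functions $\psi$ by $\int_0^\infty w(t)\psi(x(t),t)\,dt$, and $u_\delta(t)$ is the value assigned to $u$ on that curve. For the model with parameter $A$ and $u_+<u_--\frac{A}{\rho_-}$: $\sigma(t)=u_\delta(t)=v_\delta+\beta t$, $x(t)=v_\delta t+\frac12\beta t^2$, $w(t)=w_0t$, where, if $\rho_+\neq\rho_-$, $$w_0=\sqrt{\rho_+\rho_-(u_+-u_-)\Big((u_+-u_-)-\Big(\frac{A}{\rho_+}-\frac{A}{\rho_-}\Big)\Big)},\qquad v_\delta=\frac{\rho_+u_+-\rho_-u_-+w_0}{\rho_+-\rho_-},$$ and, if $\rho_+=\rho_-$, $v_\delta=\frac12\big(u_++u_--\frac{A}{\rho_-}\big)$ and $w_0=\rho_-u_--\rho_+u_+$. For the transportation equations with source term $\beta\rho$: if $\rho_+\ne\rho_-$, $$x(t)=\sigma t+\tfrac12\beta t^2,\quad w(t)=\sqrt{\rho_+\rho_-}\,(u_--u_+)t,\quad u_\delta(t)=\sigma+\beta t,\quad \sigma=\frac{\sqrt{\rho_-}\,u_-+\sqrt{\rho_+}\,u_+}{\sqrt{\rho_-}+\sqrt{\rho_+}},$$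 and, if $\rho_+=\rho_-$, $x(t)=\frac12(u_++u_-)t+\frac12\beta t^2$, $w(t)=\rho_+(u_--u_+)t$, $u_\delta(t)=\frac12(u_++u_-)+\beta t$. *)

(* Defs.v *)
From HB Require Import structures.
From mathcomp Require Import all_boot all_order all_algebra.
From mathcomp Require Import all_classical all_reals all_analysis.

Set Implicit Arguments.
Unset Strict Implicit.
Unset Printing Implicit Defensive.

Import Order.TTheory GRing.Theory Num.Theory.
Import numFieldNormedType.Exports.

Local Open Scope classical_set_scope.
Local Open Scope ring_scope.

(** Points of space-time are pairs [(x, t)]; the physical domain is [0 <= t]. *)

Section SpaceTime.
Context {R : realType}.

Definition space_time : set (R * R) := [set p | 0 <= p.2].

Definition dx (psi : R * R -> R) (p : R * R) : R := 'D_((1, 0) : R * R) psi p.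
Definition dt (psi : R * R -> R) (p : R * R) : R := 'D_((0, 1) : R * R) psi p.

Definition smooth (psi : R * R -> R) : Prop :=
  forall (vs : seq (R * R)) (p : R * R),
    differentiable (foldr (fun v f => 'D_v f) psi vs) p.

(** Test functions live on the whole plane and need not vanish at [t = 0]:
    restricted to [space_time] they are the functions of
    C_c^oo(R x [0, +oo)), so that weak formulations see the initial data. *)
Definition test_function (psi : R * R -> R) : Prop :=
  smooth psi /\ compact (closure [set p | psi p != 0]).

Definition integral_st (f : R * R -> R) : R :=
  \int[(lebesgue_measure \x lebesgue_measure)%E]_(p in space_time) f p.

End SpaceTime.

Section DeltaShock.
Context {R : realType}.

(** Data of the ansatz
      (rho, u)(x, t) = (rho_m, u_m + beta t)                     if x < x(t)
                       (w(t) delta(x - x(t)), u_delta(t))        if x = x(t)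
                       (rho_p, u_p + beta t)                     if x > x(t)
    where [position] is x(t), [strength] is w(t), [speed] is u_delta(t). *)
Record delta_wave := DeltaWave {
  friction : R;
  left_density : R;
  left_velocity : R;
  right_density : R;
  right_velocity : R;
  position : R -> R;
  strength : R -> R;
  speed : R -> R }.

Implicit Types (d : delta_wave) (beta A rho_m u_m rho_p u_p : R).

(** The absolutely continuous part of [rho]; its value on the curve, a null
    set, is irrelevant. *)
Definition regular_density d (p : R * R) : R :=
  if p.1 < position d p.2 then left_density d else right_density d.

Definition velocity d (p : R * R) : R :=
  if p.1 < position d p.2 then left_velocity d + friction d * p.2
  else if p.1 == position d p.2 then speed d p.2
  else right_velocity d + friction d * p.2.

(** P = - A / rho, which is 0 on the curve, where rho is a Dirac mass
    (1 / rho = 0). *)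
Definition pressure A d (p : R * R) : R :=
  if p.1 == position d p.2 then 0 else - (A / regular_density d p).

(** Integral of [g] against the measure [rho]: the pairing of the distribution
    [rho h] with a test function [psi] is [density_integral d (h \* psi)]. *)
Definition density_integral d (g : R * R -> R) : R :=
  integral_st (regular_density d \* g) +
  \int[lebesgue_measure]_(t in `[0, +oo[) (strength d t * g (position d t, t)).

Definition velocity_integral d (g : R * R -> R) : R :=
  integral_st (velocity d \* g).

Definition riemann_data (a b x : R) : R := if x < 0 then a else b.

(** (rho q)_t + (rho f)_x = rho s in the sense of distributions, with initial
    value [q0] for the conserved quantity [rho q]. *)
Definition weak_balance_law d (q f s : R * R -> R) (q0 : R -> R) : Prop :=
  forall psi : R * R -> R, test_function psi ->
    density_integral d (q \* dt psi) + density_integral d (f \* dx psi)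
    + \int[lebesgue_measure]_x (q0 x * psi (x, 0))
    = - density_integral d (s \* psi).

Definition delta_shock_curve d : Prop :=
  position d 0 = 0 /\
  forall t : R, 0 <= t -> is_derive t 1 (position d) (speed d t).

Definition aw_rascle_solution beta A rho_m u_m rho_p u_p d : Prop :=
  let u := velocity d in
  let P := pressure A d in
  [/\ delta_shock_curve d,
      weak_balance_law d (cst 1) u (cst 0) (riemann_data rho_m rho_p)
    & weak_balance_law d (u \+ P) (u \* (u \+ P)) (cst beta)
        (riemann_data (rho_m * (u_m - A / rho_m)) (rho_p * (u_p - A / rho_p)))].

Definition transport_solution beta rho_m u_m rho_p u_p d : Prop :=
  let u := velocity d in
  [/\ delta_shock_curve d,
      weak_balance_law d (cst 1) u (cst 0) (riemann_data rho_m rho_p)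
    & weak_balance_law d u (u \* u) (cst beta)
        (riemann_data (rho_m * u_m) (rho_p * u_p))].

Definition region_III A rho_m u_m : set (R * R) :=
  [set q | q.2 <= u_m - A / rho_m].

Definition aw_rascle_w0 A rho_m u_m rho_p u_p : R :=
  if rho_p == rho_m then rho_m * u_m - rho_p * u_p
  else Num.sqrt (rho_p * rho_m * (u_p - u_m) *
                 ((u_p - u_m) - (A / rho_p - A / rho_m))).

Definition aw_rascle_v A rho_m u_m rho_p u_p : R :=
  if rho_p == rho_m then 2^-1 * (u_p + u_m - A / rho_m)
  else (rho_p * u_p - rho_m * u_m + aw_rascle_w0 A rho_m u_m rho_p u_p)
       / (rho_p - rho_m).

Definition aw_rascle_delta_shock beta A rho_m u_m rho_p u_p : delta_wave :=
  let w0 := aw_rascle_w0 A rho_m u_m rho_p u_p in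
  let v := aw_rascle_v A rho_m u_m rho_p u_p in
  DeltaWave beta rho_m u_m rho_p u_p
    (fun t => v * t + 2^-1 * beta * t ^+ 2) (fun t => w0 * t)
    (fun t => v + beta * t).

Definition transport_w0 rho_m u_m rho_p u_p : R :=
  if rho_p == rho_m then rho_p * (u_m - u_p)
  else Num.sqrt (rho_p * rho_m) * (u_m - u_p).

Definition transport_sigma rho_m u_m rho_p u_p : R :=
  if rho_p == rho_m then 2^-1 * (u_p + u_m)
  else (Num.sqrt rho_m * u_m + Num.sqrt rho_p * u_p)
       / (Num.sqrt rho_m + Num.sqrt rho_p).

Definition transport_delta_shock beta rho_m u_m rho_p u_p : delta_wave :=
  let w0 := transport_w0 rho_m u_m rho_p u_p in
  let sigma := transport_sigma rho_m u_m rho_p u_p in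
  DeltaWave beta rho_m u_m rho_p u_p
    (fun t => sigma * t + 2^-1 * beta * t ^+ 2) (fun t => w0 * t)
    (fun t => sigma + beta * t).

(** Convergence of [(rho, u)]: both components in the sense of distributions,
    together with the position, the strength and the value of [u] on the
    curve (which distributions do not see) at every time. *)
Definition delta_wave_cvg (d : R -> delta_wave) (F : set_system R)
    (d0 : delta_wave) : Prop :=
  [/\ forall psi, test_function psi ->
        density_integral (d A) psi @[A --> F] --> density_integral d0 psi,
      forall psi, test_function psi ->
        velocity_integral (d A) psi @[A --> F] --> velocity_integral d0 psi
    & forall t : R, 0 <= t ->
        [/\ position (d A) t @[A --> F] --> position d0 t,
            strength (d A) t @[A --> F] --> strength d0 t
          & speed (d A) t @[A --> F] --> speed d0 t]].

End DeltaShock.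

(* Main.v *)
Require Import Defs.
From mathcomp Require Import all_boot all_order all_algebra.
From mathcomp Require Import all_classical all_reals all_analysis.
From mathcomp Require Import measurable_realfun.
From mathcomp Require Import ring lra.
Import Order.TTheory GRing.Theory Num.Theory.
Import numFieldNormedType.Exports.
Local Open Scope classical_set_scope.
Local Open Scope ring_scope.

(** The explicit waves solve the equations because of the Rankine-Hugoniot
    relations of a delta shock, and they converge because the Aw-Rascle wave
    depends continuously on [A], down to [A = 0] where it is the transport
    wave.

    Weak formulation.  Off the curve [x = X t] every integrand is a two-state
    function (one function of time on the left, another one on the right) times
    [psi] or a first derivative of [psi].  The shear [(y, t) |-> (y + X t, t)]
    preserves the Lebesgue measure of the half-plane and straightens the curve
    into the axis [y = 0], where Fubini and the one-variable fundamental theorem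
    of calculus give the divergence theorem [two_state_balance]: the bulk terms
    leave the initial data, the source, and an integral along the curve of
    [X'] times the jump of the density minus the jump of the flux.  The Dirac
    part, of weight [W], contributes the integral of [- W'] along the curve
    ([integral_along_curve]).  Hence a delta wave is a weak solution as soon as
    the source carried by the curve makes up for the difference of the two
    ([weak_balance_law_two_state]).  For the Aw-Rascle wave this amounts to two
    algebraic identities between [w0] and the speed [v]
    ([aw_rascle_rankine_hugoniot]), valid for all [0 <= A <= A0].

    Limit.  At [A = 0] the pressure vanishes and the two waves coincide
    ([aw_rascle_delta_shock0]), so the transport equations are the case [A = 0]
    of the same computation.  The wave depends on [A] only through [w0] and
    [v], which are continuous in [A].  After the shear, the two-state factor no
    longer depends on [v] and the test function does so continuously, so that
    integrals of two-state functions are continuous in [v] by dominated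
    convergence ([continuous_integral_two_state]).  The Dirac part reduces to
    such integrals too, because by [integral_jump_dx] an integral along the
    curve is a bulk integral against [dx psi]. *)

Section Lebesgue.
Context {R : realType}.
Implicit Types (f g psi : R * R -> R) (X a b c : R -> R).
Local Notation mu := (@lebesgue_measure R).
Local Notation mu2 := (mu \x mu)%E.
(* The space on which [mu2] is a measure; its carrier is [R * R]. *)
Local Notation plane := (measurableTypeR R * measurableTypeR R)%type.

(** * Measurability and integrability in the plane *)

(** The product sigma-algebra contains the open sets because the plane has a
    countable base of boxes with rational centre and radius. *)
Lemma open_measurable_prod (U : set (R * R)) : open U -> measurable U.
Proof.
move=> oU.
pose box (q : rat * rat * rat) : set (R * R) :=
  ball (ratr q.1.1 : R) (ratr q.2) `*` ball (ratr q.1.2 : R) (ratr q.2).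
have -> : U = \bigcup_q (if `[< box q `<=` U >] then box q else set0).
  apply/seteqP; split=> [[x y] Uxy|p [q _]]; last first.
    by case: ifPn => // /asboolP; exact.
  have [e /= e0 eU] :=
    (@nbhs_ballP _ _ _ _).1 (open_nbhs_nbhs (conj oU Uxy)).
  have e20 : 0 < e / 2 by rewrite divr_gt0.
  have [r /itvP re] := rat_in_itvoo e20.
  have approx (z : R) : exists q : rat, `|ratr q - z| < ratr r.
    have zr : z - ratr r < z + ratr r by rewrite ltrD2l gtrN// re.
    by have [q /itvP qz] := rat_in_itvoo zr; exists q; rewrite ltr_distl !qz.
  have [[a xa] [b yb]] := (approx x, approx y).
  exists (a, b, r) => //; case: ifPn => // /asboolP[] [x' y'] [/= ax' by'].
  have r2 : ratr r < e / 2 :> R by rewrite re.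
  have tri (z c z' : R) :
      `|c - z| < ratr r -> `|c - z'| < ratr r -> `|z - z'| < e.
    by rewrite !ltr_distl => /andP[? ?] /andP[? ?]; apply/andP; split; lra.
  by apply: eU; split; [exact: tri xa _|exact: tri yb _].
apply: countable_bigcupT_measurable; first exact: countableP.
move=> q; case: ifP => // _; apply: measurableX;
  exact: open_measurable (ball_open _ _).
Qed.

Lemma continuous_measurable_prod f : continuous f -> measurable_fun setT f.
Proof.
move=> cf; apply: (measurability _ (RGenOpens.measurableE R)).
move=> _ [_ [a [b ->]] <-]; rewrite setTI; apply: open_measurable_prod.
by apply: open_comp => //; exact: interval_open.
Qed.

Definition bounded_support f : Prop :=
  exists M : R, forall p, M < `|p.1| \/ M < `|p.2| -> f p = 0.

Definition locally_bounded f : Prop :=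
  forall M : R, exists K : R,
    forall p, `|p.1| <= M -> `|p.2| <= M -> `|f p| <= K.

(** The class of continuous functions with compact support; a support contained
    in an explicit square is the convenient form of compactness here. *)
Definition Cc g : Prop := continuous g /\ bounded_support g.

Lemma continuous_locally_bounded f : continuous f -> locally_bounded f.
Proof.
move=> cf M; pose B : set (R * R) := `[- M, M]%classic `*` `[- M, M]%classic.
have cB : compact (f @` B).
  apply: continuous_compact; first exact: continuous_subspaceT.
  by apply: compact_setX; exact: segment_compact.
have [K [_ /(_ (K + 1))]] := compact_bounded cB.
rewrite ltrDl ltr01 => /(_ isT) fK; exists (K + 1) => p p1 p2.
by apply: fK; exists p => //; split; rewrite /= in_itv/= -ler_norml.
Qed.

Lemma Cc_bounded g : Cc g -> exists L : R, forall p, `|g p| <= L.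
Proof.
move=> [cg [M sM]]; have [L gL] := continuous_locally_bounded _ cg M.
exists (Num.max 0 L) => p.
have [|] := pselect (M < `|p.1| \/ M < `|p.2|) =>
    [/sM ->|/not_orP[/negP + /negP]].
  by rewrite normr0 le_max lexx.
by rewrite -!leNgt le_max => p1 p2; rewrite gL ?orbT.
Qed.

Lemma continuous_time c : continuous c -> continuous (fun p : R * R => c p.2).
Proof.
move=> cc p; apply: (@continuous_comp _ _ _ snd c); last exact: cc.
exact: cvg_snd.
Qed.

Lemma continuous_bounded_itv c (M : R) : continuous c ->
  exists K : R, forall t, `|t| <= M -> `|c t| <= K.
Proof.
move=> /continuous_time/continuous_locally_bounded/(_ M)[K cK]; exists K => t tM.
by apply: (cK (0, t)); rewrite //= normr0 (le_trans _ tM).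
Qed.

Lemma integrable_bounded_support f : measurable_fun (setT : set plane) f ->
  locally_bounded f -> bounded_support f ->
  mu2.-integrable setT (EFin \o f).
Proof.
move=> mf bf [M sf].
pose B : set (R * R) := `[- M, M]%classic `*` `[- M, M]%classic.
have mB : measurable (B : set plane).
  by apply: measurableX; exact: measurable_itv.
have -> : EFin \o f = (EFin \o f) \_ B.
  apply/funext => p; rewrite patchE; case: ifPn => // /negP pB /=.
  rewrite sf//; apply: contrapT => /not_orP[/negP + /negP].
  rewrite -!leNgt !ler_norml => p1 p2; apply: pB; rewrite inE.
  by split; rewrite /= in_itv.
apply: (@integrable_mkcond _ _ _ mu2 B (EFin \o f) mB).1.
apply: (@measurable_bounded_integrable _ _ _ mu2 f B mB).
- rewrite [X in (X < _)%E](@product_measure1E _ _ _ _ _ mu mu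
    `[- M, M]%classic `[- M, M]%classic); try exact: measurable_itv.
  have fM : (mu `[(- M)%R, M]%classic < +oo)%E.
    rewrite lebesgue_measure_itv/=.
    by case: ifPn => _; rewrite ?ltry// -EFinD ltry.
  by apply: lte_mul_pinfty => //; rewrite ge0_fin_numE.
- exact: measurable_funS mf.
have [K fK] := bf M; exists K; split; first by rewrite num_real.
move=> r Kr p [/=]; rewrite !in_itv/= -!ler_norml => p1 p2.
by rewrite (le_trans _ (ltW Kr))// fK.
Qed.

Lemma measurable_space_time : measurable (space_time : set plane).
Proof.
rewrite (_ : space_time = setT `*` `[0, +oo[%classic).
  by apply: measurableX => //; exact: measurable_itv.
by apply/seteqP; split=> p /=; rewrite in_itv/= andbT; [|case].
Qed.

Lemma integral_stD f g :
  mu2.-integrable setT (EFin \o f) -> mu2.-integrable setT (EFin \o g) ->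
  integral_st (f \+ g) = integral_st f + integral_st g.
Proof.
move=> intf intg; apply: RintegralD; first exact: measurable_space_time.
- by apply: integrableS intf => //; exact: measurable_space_time.
- by apply: integrableS intg => //; exact: measurable_space_time.
Qed.

Lemma measurable_curve X : measurable_fun setT X ->
  measurable ([set p | p.1 = X p.2] : set plane).
Proof.
move=> mX.
rewrite (_ : mkset _ = (fun p => p.1 == X p.2) @^-1` [set true]); last first.
  by apply/seteqP; split=> p /= /eqP.
rewrite -[X in measurable X]setTI; apply: measurable_fun_eqr => //.
exact: measurableT_comp.
Qed.

(** At each fixed time the curve has a single point. *)
Lemma curve_null X : measurable_fun setT X ->
  mu2 [set p | p.1 = X p.2] = 0%E.
Proof.
move=> mX; have mN := measurable_curve X mX.
set N := mkset _ in mN *.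
transitivity (\int[mu2]_p (\1_N p)%:E)%E; first by rewrite integral_indic// setIT.
rewrite fubini_tonelli2//; last first.
  by apply/measurable_EFinP; exact: (@measurable_indic _ plane).
rewrite integral0_eq// => t _; rewrite /fubini_G.
rewrite -[RHS](lebesgue_measure_set1 (X t)) -[in RHS](setIT [set X t]).
by rewrite -integral_indic.
Qed.

(** The conventional values of velocity and pressure on the curve do not matter
    in the bulk integrals. *)
Lemma integral_st_eq_off_curve X f g : measurable_fun setT X ->
  measurable_fun setT f -> measurable_fun setT g ->
  (forall p, p.1 != X p.2 -> f p = g p) -> integral_st f = integral_st g.
Proof.
move=> mX mf mg fg; congr fine; apply: ae_eq_integral.
- exact: measurable_space_time.
- apply/measurable_EFinP; exact: measurable_funS mf.
- apply/measurable_EFinP; exact: measurable_funS mg.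
exists [set p | p.1 = X p.2].
split; [exact: measurable_curve|exact: curve_null|].
move=> p /=; apply: contra_notP => /eqP pX _; congr EFin; exact: fg.
Qed.

(** Almost every slice integral is finite, so the real-valued iterated integrals
    agree with the extended-real ones. *)
Lemma Fubini_st f : mu2.-integrable setT (EFin \o f) ->
  integral_st f = \int[mu]_(t in `[0, +oo[) \int[mu]_x f (x, t) /\
  integral_st f = \int[mu]_x \int[mu]_(t in `[0, +oo[) f (x, t).
Proof.
move=> intf; pose f0 := f \_ space_time.
have f0E x t : f0 (x, t) = if t \in `[0, +oo[ then f (x, t) else 0.
  rewrite /f0 patchE in_itv/= andbT (_ : ((x, t) \in space_time) = (0 <= t))//.
  by apply/idP/idP; rewrite inE.
have intf0 : mu2.-integrable setT (EFin \o f0).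
  rewrite -restrict_EFin; apply/(integrable_mkcond _ measurable_space_time).
  by apply: integrableS intf => //; exact: measurable_space_time.
have -> : integral_st f = fine (\int[mu2]_p (f0 p)%:E)%E.
  by rewrite /integral_st Rintegral_mkcond.
have aeF := @ae_filter_ringOfSetsType _ (measurableTypeR R) R mu.
have finE (F : R -> \bar R) :
    measurable_fun setT F -> {ae mu, forall t, F t \is a fin_num} ->
    (\int[mu]_t F t = \int[mu]_t (fine (F t))%:E)%E.
  move=> mF finF; apply: ae_eq_integral => //; last first.
    by move: finF; apply: (@filterS _ _ aeF) => t /= Ft _; rewrite fineK.
  by apply/measurable_EFinP; exact: measurableT_comp.
split.
- rewrite -(integral21_prod_meas1 intf0) [RHS]Rintegral_mkcond finE.
  + congr fine; apply: eq_integral => t _; congr EFin.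
    rewrite /fubini_G patchE mem_setE.
    under eq_integral do rewrite /= f0E.
    by case: ifP => // _; rewrite integral0.
  + exact: (measurable_fubini_G intf0).
  + have := ae_integrable2 intf0.
    apply: (@filterS _ _ aeF) => t; exact: integrable_fin_num.
- rewrite -(integral12_prod_meas1 intf0) finE.
  + congr fine; apply: eq_integral => x _; congr EFin.
    rewrite [RHS]Rintegral_mkcond.
    by congr fine; apply: eq_integral => t _; rewrite /= f0E patchE mem_setE.
  + exact: (measurable_fubini_F intf0).
  + have := ae_integrable1 intf0.
    apply: (@filterS _ _ aeF) => t; exact: integrable_fin_num.
Qed.

(** * Shearing the half-plane *)

Lemma Rintegral_translation (h : R -> R) (c : R) : measurable_fun setT h ->
  \int[mu]_x h (x + c) = \int[mu]_x h x.
Proof.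
move=> mh; have mc : measurable_fun setT (fun x : R => x + c).
  exact: measurable_funD.
pose phi : measurableTypeR R -> measurableTypeR R := fun x : R => x + c.
(* Lebesgue measure is characterised by its values on the intervals. *)
have pushc (A : set (measurableTypeR R)) : measurable A ->
    lebesgue_measure A = pushforward mu phi A.
  move=> mA; apply: lebesgue_measure_unique => //= _ [[a b]] _ <-.
  rewrite /pushforward (_ : phi @^-1` _ = `]a - c, b - c]%classic); last first.
    by apply/seteqP; split=> x; rewrite /= !in_itv/= ltrBlDr lerBrDr.
  rewrite !lebesgue_measure_itv/= !lte_fin ltrD2r -!EFinB.
  by rewrite (_ : b - c - (a - c) = b - a)//; ring.
have ge0_case (g : R -> \bar R) :
    measurable_fun setT g -> (forall x, 0 <= g x)%E ->
    (\int[mu]_x g (x + c)%R = \int[mu]_x g x)%E.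
  move=> mg g0.
  rewrite -[LHS](@ge0_integral_pushforward _ _ (measurableTypeR R)
    (measurableTypeR R) R phi mc mu setT g)//.
  by apply: eq_measure_integral => A mA _; exact: esym (pushc A mA).
have mEh : measurable_fun setT (EFin \o h) by exact/measurable_EFinP.
congr fine; rewrite [LHS]integralE [RHS]integralE; congr (_ - _)%E.
- rewrite -[RHS](ge0_case _ (measurable_funepos mEh))//.
  by apply: eq_integral => x _; rewrite !funeposE.
- rewrite -[RHS](ge0_case _ (measurable_funeneg mEh))//.
  by apply: eq_integral => x _; rewrite !funenegE.
Qed.

(** Straightens the curve: [shear X] maps the axis [y = 0] onto [x = X t]. *)
Definition shear X (p : R * R) : R * R := (p.1 + X p.2, p.2).

Lemma integral_st_shear f X :
  mu2.-integrable setT (EFin \o f) ->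
  mu2.-integrable setT (EFin \o (f \o shear X)) ->
  integral_st f = integral_st (f \o shear X).
Proof.
move=> if1 if2.
have mf : measurable_fun setT f.
  by apply/measurable_EFinP; exact: measurable_int if1.
rewrite (Fubini_st _ if1).1 (Fubini_st _ if2).1.
apply: eq_Rintegral => t _ /=; rewrite /shear/=.
by rewrite (Rintegral_translation (fun x => f (x, t)))//; apply: measurableT_comp.
Qed.

Lemma continuous_shear X : continuous X -> continuous (shear X).
Proof.
move=> cX p.
have c1 : {for p, continuous (fun q : R * R => q.1 + X q.2)}.
  apply: continuousD; first exact: cvg_fst.
  exact: continuous_time.
exact: (cvg_pair c1 (@cvg_snd _ _ _ _ _)).
Qed.

Lemma continuous_comp_shear f X : continuous X -> continuous f ->
  continuous (f \o shear X).
Proof.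
by move=> cX cf p; apply: continuous_comp; [exact: continuous_shear|exact: cf].
Qed.

Lemma Cc_shear g X : continuous X -> Cc g -> Cc (g \o shear X).
Proof.
move=> cX [cg [M sg]]; split; first exact: continuous_comp_shear.
have [K XK] := continuous_bounded_itv X M cX.
exists (Num.max M (M + K)) => p pM; apply: sg; rewrite /=.
have [tM|tM] := ltP M `|p.2|; first by right.
left; case: pM; rewrite gt_max => /andP[? ?]; last lra.
have := XK _ tM; have := lerB_dist p.1 (- X p.2).
by rewrite opprK normrN => ? ?; lra.
Qed.

Definition two_state X a b (p : R * R) : R :=
  if p.1 < X p.2 then a p.2 else b p.2.

Lemma two_state_shear X a b p :
  two_state X a b (shear X p) = two_state (cst 0) a b p.
Proof. by rewrite /two_state/= gtrDr. Qed.

Lemma measurable_two_state X a b :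
  continuous X -> continuous a -> continuous b ->
  measurable_fun setT (two_state X a b).
Proof.
move=> /continuous_measurable_fun mX /continuous_measurable_fun ma.
move=> /continuous_measurable_fun mb.
by apply: measurable_fun_ifT; first apply: measurable_fun_ltr => //;
  exact: measurableT_comp.
Qed.

Lemma locally_bounded_two_state X a b : continuous a -> continuous b ->
  locally_bounded (two_state X a b).
Proof.
move=> ca cb M; have [K aK] := continuous_bounded_itv a M ca.
have [L bL] := continuous_bounded_itv b M cb.
exists (Num.max K L) => p _ pM; rewrite /two_state le_max.
by case: ifP => _; rewrite ?aK ?bL ?orbT.
Qed.

Lemma integrable_two_state X a b g :
  continuous X -> continuous a -> continuous b -> Cc g ->
  mu2.-integrable setT (EFin \o (two_state X a b \* g)).
Proof.
move=> cX ca cb [cg [N sg]]; apply: integrable_bounded_support.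
- apply: measurable_funM; first exact: measurable_two_state.
  exact: continuous_measurable_prod.
- move=> M; have [K hK] := locally_bounded_two_state X a b ca cb M.
  have [L gL] := continuous_locally_bounded _ cg M.
  by exists (K * L) => p p1 p2; rewrite normrM ler_pM ?hK ?gL.
- by exists N => p /sg gp; rewrite /= gp mulr0.
Qed.

Lemma integral_two_state_shear X a b g :
  continuous X -> continuous a -> continuous b -> Cc g ->
  integral_st (two_state X a b \* g) =
  integral_st (two_state (cst 0) a b \* (g \o shear X)).
Proof.
move=> cX ca cb cg.
have E : (two_state X a b \* g) \o shear X =
    two_state (cst 0) a b \* (g \o shear X).
  by apply/funext => p; rewrite /= two_state_shear.
rewrite -E; apply: integral_st_shear; first exact: integrable_two_state.
by rewrite E; apply: integrable_two_state => //;
  [exact: cst_continuous|exact: Cc_shear].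
Qed.

(** * Calculus on the line *)

Definition C1 (F F' : R -> R) : Prop :=
  continuous F' /\ forall t : R, is_derive t 1 F (F' t).

Lemma C1_continuous (F F' : R -> R) : C1 F F' -> continuous F.
Proof.
move=> [_ dF] t; apply/differentiable_continuous/derivable1_diffP.
by have := dF t.
Qed.

Lemma continuous_affine (r s : R) : continuous (fun t => r + s * t).
Proof.
apply: (@C1_continuous _ (cst s)); split; first exact: cst_continuous.
by move=> t; apply: is_derive_eq; rewrite /GRing.scale/=; ring.
Qed.

Lemma continuous_id : continuous (@id R).
Proof. by move=> t; exact: cvg_id. Qed.

Lemma continuous_mul a b : continuous a -> continuous b ->
  continuous (fun t => a t * b t).
Proof. by move=> ca cb t; apply: cvgM; [exact: ca|exact: cb]. Qed.

Lemma continuous_sub a b : continuous a -> continuous b ->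
  continuous (fun t => a t - b t).
Proof. by move=> ca cb t; apply: cvgB; [exact: ca|exact: cb]. Qed.

Lemma measurable_halfline :
  measurable (`[0, +oo[%classic : set (measurableTypeR R)).
Proof. exact: measurable_itv. Qed.

Lemma interval_FTC (F F' : R -> R) (a b : R) : a < b -> C1 F F' ->
  \int[mu]_(x in `[a, b]) F' x = F b - F a.
Proof.
move=> ab FF'; have cF := C1_continuous _ _ FF'; have [cF' dF] := FF'.
rewrite /Rintegral (@continuous_FTC2 _ F' F a b) //.
- exact: continuous_subspaceT.
- by split; [move=> x _|apply: cvg_at_right_filter; exact: cF
    |apply: cvg_at_left_filter; exact: cF].
- by move=> x _; rewrite derive1E derive_val.
Qed.

Lemma Rintegral_support (h : R -> R) (D E : set R) :
  E `<=` D -> (forall x, D x -> ~ E x -> h x = 0) ->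
  \int[mu]_(x in D) h x = \int[mu]_(x in E) h x.
Proof.
move=> ED h0; rewrite (Rintegral_mkcond mu D) (Rintegral_mkcond mu E).
apply: eq_Rintegral => x _; rewrite !patchE.
case: (pselect (E x)) => [Ex|nEx]; first by rewrite !mem_set//; exact: ED.
rewrite (memNset nEx); case: ifPn => // /set_mem Dx; exact: h0.
Qed.

Lemma integral_derivative (F F' : R -> R) (M : R) : C1 F F' ->
  (forall x, M < `|x| -> F x = 0) -> (forall x, M < `|x| -> F' x = 0) ->
  \int[mu]_x F' x = 0 /\ \int[mu]_(t in `[0, +oo[) F' t = - F 0.
Proof.
move=> FF' sF sF'; pose N := `|M| + 1.
have N0 : 0 < N by rewrite ltr_wpDl.
have MN : M < N by rewrite (le_lt_trans (ler_norm M))// ltrDl.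
have FN : F N = 0 by apply: sF; rewrite gtr0_norm.
have FNN : F (- N) = 0 by apply: sF; rewrite normrN gtr0_norm.
split.
- rewrite (Rintegral_support _ _ `[- N, N]%classic)//.
    by rewrite (interval_FTC _ _ _ _ _ FF') ?FN ?FNN ?subrr// gtrN.
  move=> x _ /negP; rewrite in_itv/= -ler_norml -ltNge => Nx.
  by apply: sF'; exact: lt_trans Nx.
- rewrite (Rintegral_support _ _ `[0, N]%classic)//.
  + by rewrite (interval_FTC _ _ _ _ _ FF') ?FN ?sub0r.
  + by move=> x; rewrite /= !in_itv/= andbT => /andP[].
  move=> x; rewrite /= !in_itv/= andbT => x0; rewrite x0 => /negP/=.
  rewrite -ltNge => Nx.
  by apply: sF'; rewrite ger0_norm//; exact: lt_trans Nx.
Qed.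

Lemma integrable_line (h : R -> R) (M : R) : continuous h ->
  (forall x, M < `|x| -> h x = 0) -> mu.-integrable setT (EFin \o h).
Proof.
move=> ch sh.
have -> : EFin \o h =
    (EFin \o h) \_ (`[- M, M]%classic : set (measurableTypeR R)).
  apply/funext => x; rewrite patchE; case: ifPn => //.
  rewrite notin_setE /= => /negP.
  by rewrite in_itv/= -ler_norml -ltNge => /sh ->.
apply: (@integrable_mkcond _ _ _ mu `[- M, M]%classic (EFin \o h) _).1.
  exact: measurable_itv.
apply: continuous_compact_integrable; first exact: segment_compact.
exact: continuous_subspaceT.
Qed.

Lemma integral_step (h : R -> R) (M a b : R) : continuous h ->
  (forall x, M < `|x| -> h x = 0) ->
  mu.-integrable setT (EFin \o (fun x => (if x < 0 then a else b) * h x)) /\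
  \int[mu]_x ((if x < 0 then a else b) * h x) =
  a * \int[mu]_x h x + (b - a) * \int[mu]_(x in `[0, +oo[) h x.
Proof.
move=> ch sh; have ih := integrable_line h M ch sh.
have mI := measurable_halfline.
have ih0 : mu.-integrable setT (EFin \o (h \_ `[0, +oo[)).
  rewrite -restrict_EFin.
  apply: (@integrable_mkcond _ _ _ mu _ (EFin \o h) mI).1.
  exact: integrableS ih.
have iah : mu.-integrable setT (EFin \o (fun x => a * h x)).
  exact: (@integrableZl _ _ _ mu setT measurableT a (EFin \o h) ih).
have ibh : mu.-integrable setT
    (EFin \o (fun x => (b - a) * (h \_ `[0, +oo[) x)).
  exact: (@integrableZl _ _ _ mu setT measurableT (b - a) _ ih0).
have E : (fun x => (if x < 0 then a else b) * h x) =
    (fun x => a * h x + (b - a) * (h \_ `[0, +oo[) x).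
  apply/funext => x.
  have -> : (h \_ `[0, +oo[) x = if x < 0 then 0 else h x.
    by rewrite patchE mem_setE in_itv/= andbT leNgt; case: (x < 0).
  by case: ifP => _; ring.
rewrite E; split; first exact: (integrableD measurableT iah ibh).
rewrite RintegralD// RintegralZl// RintegralZl//.
by rewrite [in RHS](Rintegral_mkcond mu `[0, +oo[%classic h).
Qed.

(** * Test functions *)

Lemma is_derive_curve psi (g1 g2 : R -> R) (s d1 d2 : R) :
  differentiable psi (g1 s, g2 s) ->
  is_derive s 1 g1 d1 -> is_derive s 1 g2 d2 ->
  is_derive s 1 (fun s => psi (g1 s, g2 s))
    (d1 * dx psi (g1 s, g2 s) + d2 * dt psi (g1 s, g2 s)).
Proof.
move=> dpsi dg1 dg2.
have df1 : differentiable g1 s by apply/derivable1_diffP.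
have df2 : differentiable g2 s by apply/derivable1_diffP.
have dg : differentiable (fun s => (g1 s, g2 s)) s.
  exact: differentiable_pair.
have dc : differentiable (psi \o (fun s => (g1 s, g2 s))) s.
  exact: differentiable_comp.
apply: DeriveDef; first exact: diff_derivable.
rewrite deriveE// diff_comp//= diff_pair//= -!deriveE// !derive_val.
rewrite (_ : (d1, d2) = d1 *: (1, 0) + d2 *: (0, 1) :> R * R); last first.
  by congr pair; rewrite /= ?scaler0 ?addr0 ?add0r /GRing.scale/= mulr1.
by rewrite deriveE// linearD !linearZ/= /dx /dt !deriveE.
Qed.

Lemma bounded_support_derive f (v : R * R) :
  bounded_support f -> bounded_support ('D_v f).
Proof.
move=> [M sf]; exists M => p pM.
have far (pr : R * R -> R) : continuous pr -> M < `|pr p| ->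
    \forall q \near p, M < `|pr q|.
  move=> cpr Mp; have cn : `|pr q| @[q --> p] --> `|pr p|.
    by apply: cvg_norm; exact: cpr.
  exact: (@cvgr_gt R _ (nbhs p) _ (fun q => `|pr q|) `|pr p| cn M Mp).
have : \forall q \near p, f q = cst 0 q.
  case: pM => [/(far fst)|/(far snd)] farp.
  - by apply: filterS (farp _) => [q qM|q]; [apply: sf; left|exact: cvg_fst].
  - by apply: filterS (farp _) => [q qM|q]; [apply: sf; right|exact: cvg_snd].
by move=> /near_eq_derive ->; rewrite derive_cst.
Qed.

Lemma test_function_bounded_support psi :
  test_function psi -> bounded_support psi.
Proof.
move=> [_ /compact_bounded[K [_ /(_ (K + 1))]]].
rewrite ltrDl ltr01 => /(_ isT) sK.
exists (K + 1) => p pK; apply: contrapT => /eqP psip.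
have := sK p (@subset_closure _ [set p | psi p != 0] p psip).
rewrite /= leNgt => /negP; apply.
by rewrite prod_normE lt_max; case: pK => ->; rewrite ?orbT.
Qed.

Lemma test_function_differentiable psi p :
  test_function psi -> differentiable psi p.
Proof. by move=> [/(_ [::])]. Qed.

Lemma Cc_test_function psi :
  test_function psi -> [/\ Cc psi, Cc (dx psi) & Cc (dt psi)].
Proof.
move=> tpsi; have spsi := test_function_bounded_support psi tpsi.
have CcD v : Cc ('D_v psi).
  split; last exact: bounded_support_derive.
  by move=> p; apply: differentiable_continuous; exact: (tpsi.1 [:: v]).
split; [split=> // p|exact: CcD|exact: CcD].
exact/differentiable_continuous/test_function_differentiable.
Qed.

Lemma continuous_along f X : continuous X -> continuous f ->
  continuous (fun t => f (X t, t)).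
Proof.
move=> cX cf t.
apply: (@continuous_comp _ _ _ (fun t => (X t, t)) f); last exact: cf.
exact: (cvg_pair (cX t) cvg_id).
Qed.

Lemma continuous_slice_x f (t : R) : continuous f ->
  continuous (fun x => f (x, t)).
Proof.
move=> cf x; apply: (@continuous_comp _ _ _ (fun x => (x, t)) f); last exact: cf.
exact: (cvg_pair cvg_id (cvg_cst t)).
Qed.

(** What integration by parts uses of a sheared test function; such a function
    need not be smooth, since [X] is only differentiable once. *)
Record C1c (phi px pt : R * R -> R) : Prop := {
  C1c_fun : Cc phi;
  C1c_dx : Cc px;
  C1c_dt : Cc pt;
  C1c_derive_x : forall x t : R, is_derive x 1 (fun x => phi (x, t)) (px (x, t));
  C1c_derive_t : forall x t : R, is_derive t 1 (fun t => phi (x, t)) (pt (x, t))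
}.

Definition sheared_dt psi X (X' : R -> R) : R * R -> R :=
  (dt psi \o shear X) \+ (fun p => X' p.2 * dx psi (shear X p)).

Lemma C1c_shear psi X X' : test_function psi -> C1 X X' ->
  C1c (psi \o shear X) (dx psi \o shear X) (sheared_dt psi X X').
Proof.
move=> tpsi XX'; have cX := C1_continuous _ _ XX'; have [cX' dX] := XX'.
have [Cpsi Cdx Cdt] := Cc_test_function psi tpsi.
have [[csx [M sM]] [cst_ [N sN]]] := (Cc_shear _ X cX Cdx, Cc_shear _ X cX Cdt).
split; [exact: Cc_shear|exact: Cc_shear|split| |].
- move=> p; apply: cvgD; first exact: cst_.
  by apply: cvgM; [exact: continuous_time|exact: csx].
- exists (Num.max M N) => p; rewrite !gt_max /sheared_dt/= => pMN.
  have -> : dt psi (shear X p) = 0.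
    by apply: sN; case: pMN => /andP[? ?]; [left|right].
  have -> : dx psi (shear X p) = 0.
    by apply: sM; case: pMN => /andP[? ?]; [left|right].
  by rewrite mulr0 addr0.
- move=> x t; have dpsi := test_function_differentiable psi (x + X t, t) tpsi.
  have dx1 : is_derive x 1 (fun x : R => x + X t) 1.
    by apply: is_derive_eq; rewrite addr0.
  have := is_derive_curve psi (fun x => x + X t) (cst t) x _ _ dpsi dx1
    (is_derive_cst t x 1).
  by rewrite mul1r mul0r addr0.
- move=> x t; have dpsi := test_function_differentiable psi (x + X t, t) tpsi.
  have dX_ := dX t.
  have dt1 : is_derive t 1 (fun t : R => x + X t) (X' t).
    by apply: is_derive_eq; rewrite add0r mul1r.
  have := is_derive_curve psi (fun t => x + X t) id t _ _ dpsi dt1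
    (is_derive_id t 1).
  by rewrite mul1r addrC.
Qed.

(** * Balance laws of two-state functions *)

Section Straightened.
Variables phi px pt : R * R -> R.
Hypothesis phiC1 : C1c phi px pt.

Lemma integral_jump_dx a b : continuous a -> continuous b ->
  integral_st (two_state (cst 0) a b \* px) =
  \int[mu]_(t in `[0, +oo[) ((a t - b t) * phi (0, t)).
Proof.
case: phiC1 => -[_ [Mphi sphi]] Cpx _ dphi _ ca cb.
have i1 : mu2.-integrable setT (EFin \o (two_state (cst 0) a b \* px)).
  by apply: integrable_two_state => //; exact: cst_continuous.
rewrite (Fubini_st _ i1).1; apply: eq_Rintegral => t _.
have [cpx [Mpx spx]] := Cpx; pose M := Num.max Mphi Mpx.
have sphi_t x : M < `|x| -> phi (x, t) = 0.
  by rewrite gt_max => /andP[? ?]; apply: sphi; left.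
have spx_t x : M < `|x| -> px (x, t) = 0.
  by rewrite gt_max => /andP[? ?]; apply: spx; left.
have cpx_t := continuous_slice_x px t cpx.
have -> := (integral_step _ M (a t) (b t) cpx_t spx_t).2.
have [-> ->] := integral_derivative (fun x => phi (x, t)) _ M
  (conj cpx_t (fun x => dphi x t)) sphi_t spx_t.
by ring.
Qed.

Lemma integral_two_state_dt a1 a2 a1' a2' : C1 a1 a1' -> C1 a2 a2' ->
  integral_st (two_state (cst 0) a1 a2 \* pt)
    + integral_st (two_state (cst 0) a1' a2' \* phi) =
  - \int[mu]_x (riemann_data (a1 0) (a2 0) x * phi (x, 0)).
Proof.
case: phiC1 => Cphi _ Cpt _ dphi C1a1 C1a2.
have [ca1 ca2] := (C1_continuous _ _ C1a1, C1_continuous _ _ C1a2).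
have i1 : mu2.-integrable setT (EFin \o (two_state (cst 0) a1 a2 \* pt)).
  by apply: integrable_two_state => //; exact: cst_continuous.
have i2 : mu2.-integrable setT (EFin \o (two_state (cst 0) a1' a2' \* phi)).
  apply: integrable_two_state => //; first exact: cst_continuous.
  - exact: C1a1.1.
  - exact: C1a2.1.
rewrite -integral_stD// (Fubini_st _ _).2; last first.
  exact: (integrableD measurableT i1 i2).
have [[cphi [Mphi sphi]] [cpt [Mpt spt]]] := (Cphi, Cpt).
have [ir _] := integral_step _ Mphi (a1 0) (a2 0) (continuous_slice_x phi 0 cphi)
  (fun x Mx => sphi (x, 0) (or_introl Mx)).
rewrite -mulN1r -RintegralZl//; apply: eq_Rintegral => x _.
pose M := Num.max Mphi Mpt.
(* On the vertical line at [x] the two integrands add up to [(a * phi)']. *)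
pose a := if x < 0 then a1 else a2; pose a' := if x < 0 then a1' else a2'.
have C1a : C1 a a' by rewrite /a /a'; case: ifP.
pose F t := a t * phi (x, t); pose F' t := a t * pt (x, t) + a' t * phi (x, t).
have csx f : continuous f -> continuous (fun t => f (x, t)).
  by apply: continuous_along; exact: cst_continuous.
have C1F : C1 F F'.
  split=> t; last first.
    have da_ := C1a.2 t; have dp_ := dphi x t.
    by apply: is_derive_eq; rewrite /F' /GRing.scale/=; ring.
  by apply: cvgD; apply: cvgM;
    [exact: (C1_continuous _ _ C1a)|exact: csx|exact: C1a.1|exact: csx].
have sF t : M < `|t| -> F t = 0.
  by rewrite gt_max => /andP[? ?]; rewrite /F sphi ?mulr0//; right.
have sF' t : M < `|t| -> F' t = 0.
  by rewrite gt_max => /andP[? ?]; rewrite /F' sphi ?spt ?mulr0 ?addr0//; right.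
have [_ I] := integral_derivative _ _ _ C1F sF sF'.
transitivity (- F 0); last first.
  by rewrite /F mulN1r /a /riemann_data; case: ifP.
rewrite -I; apply: eq_Rintegral => t _.
by rewrite /F' /a /a' /two_state/=; case: ifP.
Qed.

End Straightened.

(** The divergence theorem for a two-state field: in the coordinates of the
    shear, [dt psi] is the time derivative of [psi \o shear X] minus [X'] times
    its space derivative, so the flux through the curve is [b - X' a]. *)
Lemma two_state_balance psi X X' a1 a2 a1' a2' b1 b2 :
  test_function psi -> C1 X X' -> X 0 = 0 -> C1 a1 a1' -> C1 a2 a2' ->
  continuous b1 -> continuous b2 ->
  integral_st (two_state X a1 a2 \* dt psi)
    + integral_st (two_state X b1 b2 \* dx psi)
    + \int[mu]_x (riemann_data (a1 0) (a2 0) x * psi (x, 0))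
  = \int[mu]_(t in `[0, +oo[)
      ((X' t * (a2 t - a1 t) - (b2 t - b1 t)) * psi (X t, t))
    - integral_st (two_state X a1' a2' \* psi).
Proof.
move=> tpsi C1X X0 C1a1 C1a2 cb1 cb2.
have cX := C1_continuous _ _ C1X; have cX' := C1X.1.
have ca1 := C1_continuous _ _ C1a1; have ca2 := C1_continuous _ _ C1a2.
have phiC1 := C1c_shear psi X X' tpsi C1X.
have [Cphi Cpx Cpt _ _] := phiC1.
have [Cpsi Cdx Cdt] := Cc_test_function psi tpsi.
have c0 : continuous (cst 0 : R -> R) by exact: cst_continuous.
pose e1 t := b1 t - a1 t * X' t; pose e2 t := b2 t - a2 t * X' t.
have ce1 : continuous e1 by apply: continuous_sub => //; exact: continuous_mul.
have ce2 : continuous e2 by apply: continuous_sub => //; exact: continuous_mul.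
set px := dx psi \o shear X in phiC1 Cpx.
set pt := sheared_dt psi X X' in phiC1 Cpt.
have -> : integral_st (two_state X a1 a2 \* dt psi)
      + integral_st (two_state X b1 b2 \* dx psi)
    = integral_st (two_state (cst 0) a1 a2 \* pt)
      + integral_st (two_state (cst 0) e1 e2 \* px).
  rewrite (integral_two_state_shear _ _ _ _ cX ca1 ca2 Cdt).
  rewrite (integral_two_state_shear _ _ _ _ cX cb1 cb2 Cdx).
  rewrite -(integral_stD _ _
    (integrable_two_state _ _ _ _ c0 ca1 ca2 (Cc_shear _ X cX Cdt))
    (integrable_two_state _ _ _ _ c0 cb1 cb2 Cpx)).
  rewrite -(integral_stD _ _ (integrable_two_state _ _ _ _ c0 ca1 ca2 Cpt)
    (integrable_two_state _ _ _ _ c0 ce1 ce2 Cpx)).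
  congr integral_st; apply/funext => p.
  by rewrite /pt /px /sheared_dt /e1 /e2 /two_state/=; case: ifP => _; ring.
rewrite (integral_two_state_shear _ _ _ _ cX C1a1.1 C1a2.1 Cpsi).
rewrite (integral_jump_dx _ _ _ phiC1 _ _ ce1 ce2).
have := integral_two_state_dt _ _ _ phiC1 _ _ _ _ C1a1 C1a2.
rewrite [X in - \int[mu]_x X x](_ : _ =
    fun x => riemann_data (a1 0) (a2 0) x * psi (x, 0)); last first.
  by apply/funext => x; rewrite /= /shear/= X0 addr0.
rewrite (_ : \int[mu]_(t in `[0, +oo[) ((e1 t - e2 t) * (psi \o shear X) (0, t))
  = \int[mu]_(t in `[0, +oo[)
      ((X' t * (a2 t - a1 t) - (b2 t - b1 t)) * psi (X t, t))); last first.
  apply: eq_Rintegral => t _; rewrite /shear/= add0r /e1 /e2.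
  by congr (_ * _); ring.
have alg (A B C D : R) : A + B = - C -> A + D + C = D - B by lra.
exact: alg.
Qed.

Lemma integrable_along c g X : continuous c -> continuous X -> Cc g ->
  mu.-integrable `[0, +oo[ (EFin \o (fun t => c t * g (X t, t))).
Proof.
move=> cc cX Cg; have [_ [M sM]] := Cc_shear _ X cX Cg.
have i : mu.-integrable setT (EFin \o (fun t => c t * g (X t, t))).
  apply: (integrable_line _ M).
    by apply: continuous_mul => //; exact: (continuous_along _ _ cX Cg.1).
  move=> t Mt; have := sM (0, t) (or_intror Mt).
  by rewrite /shear/= add0r => ->; rewrite mulr0.
by apply: integrableS i => //; exact: measurable_itv.
Qed.

(** The convective derivative [dt psi + X' dx psi] is the derivative of [psi]
    along the curve. *)
Lemma integral_along_curve psi X X' (W W' : R -> R) :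
  test_function psi -> C1 X X' -> C1 W W' ->
  \int[mu]_(t in `[0, +oo[) (W t * dt psi (X t, t))
    + \int[mu]_(t in `[0, +oo[) (W t * X' t * dx psi (X t, t))
  = - (W 0 * psi (X 0, 0)) - \int[mu]_(t in `[0, +oo[) (W' t * psi (X t, t)).
Proof.
move=> tpsi C1X C1W.
have [cX cW] := (C1_continuous _ _ C1X, C1_continuous _ _ C1W).
have [Cpsi Cdx Cdt] := Cc_test_function psi tpsi.
have mI := measurable_halfline.
have i1 := integrable_along _ _ _ cW cX Cdt.
have i2 := integrable_along _ _ _ (continuous_mul _ _ cW C1X.1) cX Cdx.
have i3 := integrable_along _ _ _ C1W.1 cX Cpsi.
have [[cphi [M sM]] _ [cphit [N sN]] _ dphi] := C1c_shear psi X X' tpsi C1X.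
pose phi := psi \o shear X; pose phit := sheared_dt psi X X'.
have c0 : continuous (cst 0 : R -> R) by exact: cst_continuous.
pose F t := W t * phi (0, t).
pose F' t := W t * phit (0, t) + W' t * phi (0, t).
have C1F : C1 F F'.
  split=> t; last first.
    have dW_ := C1W.2 t; have dp_ := dphi 0 t.
    by apply: is_derive_eq; rewrite /F' /phi /phit /GRing.scale/=; ring.
  have cphi0 := continuous_along _ _ c0 cphi.
  have cphit0 := continuous_along _ _ c0 cphit.
  by apply: cvgD; apply: cvgM;
    [exact: cW|exact: cphit0|exact: C1W.1|exact: cphi0].
have sF t : Num.max M N < `|t| -> F t = 0.
  by rewrite gt_max => /andP[? ?]; rewrite /F /phi sM ?mulr0//; right.
have sF' t : Num.max M N < `|t| -> F' t = 0.
  rewrite gt_max => /andP[? ?].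
  by rewrite /F' /phi /phit sM ?sN ?mulr0 ?addr0//; right.
have [_ I] := integral_derivative _ _ _ C1F sF sF'.
have -> : W 0 * psi (X 0, 0) = F 0 by rewrite /F /phi /shear/= add0r.
rewrite -I; apply/eqP; rewrite eq_sym subr_eq; apply/eqP.
rewrite -RintegralD// -RintegralD//; last exact: (integrableD mI i1 i2).
apply: eq_Rintegral => t _.
by rewrite /F' /phi /phit /sheared_dt /shear/= add0r; ring.
Qed.

(** A criterion for delta waves: [a] and [b] are the densities and fluxes on the
    two sides of the curve and [W] is the weight of the conserved quantity
    carried by it.  The last condition, on the source carried by the curve, is
    the generalised Rankine-Hugoniot relation. *)
Lemma weak_balance_law_two_state (d : delta_wave) (q f s : R * R -> R)
    (X' W W' a1 a2 a1' a2' b1 b2 : R -> R) :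
  let X := position d in
  X 0 = 0 -> W 0 = 0 -> C1 X X' -> C1 W W' -> C1 a1 a1' -> C1 a2 a2' ->
  continuous b1 -> continuous b2 ->
  measurable_fun setT q -> measurable_fun setT f -> measurable_fun setT s ->
  (forall p, p.1 != X p.2 ->
    [/\ regular_density d p * q p = two_state X a1 a2 p,
        regular_density d p * f p = two_state X b1 b2 p
      & regular_density d p * s p = two_state X a1' a2' p]) ->
  (forall t,
    [/\ strength d t * q (X t, t) = W t,
        strength d t * f (X t, t) = W t * X' t
      & strength d t * s (X t, t) =
        W' t - (X' t * (a2 t - a1 t) - (b2 t - b1 t))]) ->
  weak_balance_law d q f s (riemann_data (a1 0) (a2 0)).
Proof.
move=> X X0 W0 C1X C1W C1a1 C1a2 cb1 cb2 mq mf ms off on psi tpsi.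
have [cX cW] := (C1_continuous _ _ C1X, C1_continuous _ _ C1W).
have [ca1 ca2] := (C1_continuous _ _ C1a1, C1_continuous _ _ C1a2).
have [Cpsi Cdx Cdt] := Cc_test_function psi tpsi.
have mX := continuous_measurable_fun cX.
have mrho : measurable_fun setT (regular_density d).
  exact: (measurable_two_state _ _ _ cX
    (@cst_continuous _ _ (left_density d))
    (@cst_continuous _ _ (right_density d))).
have bulk (g h : R * R -> R) (e1 e2 : R -> R) :
    measurable_fun setT g -> continuous h -> continuous e1 -> continuous e2 ->
    (forall p, p.1 != X p.2 -> regular_density d p * g p = two_state X e1 e2 p) ->
    integral_st (regular_density d \* (g \* h))
    = integral_st (two_state X e1 e2 \* h).
  move=> mg ch ce1 ce2 E; have mh := continuous_measurable_prod h ch.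
  apply: (integral_st_eq_off_curve _ _ _ mX).
  - by apply: measurable_funM => //; exact: measurable_funM.
  - by apply: measurable_funM => //; exact: measurable_two_state.
  by move=> p pX; rewrite /= mulrA E.
have Eq := bulk q (dt psi) a1 a2 mq Cdt.1 ca1 ca2
  (fun p pX => let: And3 h _ _ := off p pX in h).
have Ef := bulk f (dx psi) b1 b2 mf Cdx.1 cb1 cb2
  (fun p pX => let: And3 _ h _ := off p pX in h).
have Es := bulk s psi a1' a2' ms Cpsi.1 C1a1.1 C1a2.1
  (fun p pX => let: And3 _ _ h := off p pX in h).
rewrite /density_integral Eq Ef Es {Eq Ef Es}.
have -> : \int[mu]_(t in `[0, +oo[) (strength d t * (q \* dt psi) (X t, t)) =
    \int[mu]_(t in `[0, +oo[) (W t * dt psi (X t, t)).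
  by apply: eq_Rintegral => t _ /=; rewrite mulrA; have [-> _ _] := on t.
have -> : \int[mu]_(t in `[0, +oo[) (strength d t * (f \* dx psi) (X t, t)) =
    \int[mu]_(t in `[0, +oo[) (W t * X' t * dx psi (X t, t)).
  by apply: eq_Rintegral => t _ /=; rewrite mulrA; have [_ -> _] := on t.
pose J t := X' t * (a2 t - a1 t) - (b2 t - b1 t).
have cJ : continuous J.
  apply: continuous_sub; last exact: continuous_sub.
  by apply: continuous_mul; [exact: C1X.1|exact: continuous_sub].
have -> : \int[mu]_(t in `[0, +oo[) (strength d t * (s \* psi) (X t, t)) =
    \int[mu]_(t in `[0, +oo[) (W' t * psi (X t, t))
    - \int[mu]_(t in `[0, +oo[) (J t * psi (X t, t)).
  rewrite -(RintegralB (mu := mu) measurable_halfline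
    (integrable_along _ _ _ C1W.1 cX Cpsi) (integrable_along _ _ _ cJ cX Cpsi)).
  by apply: eq_Rintegral => t _ /=; rewrite mulrA -mulrBl; have [_ _ ->] := on t.
have alg (A1 A2 A3 C1 C2 CW CJ I : R) :
  A1 + A2 + I = CJ - A3 -> C1 + C2 = - CW ->
  A1 + C1 + (A2 + C2) + I = - (A3 + (CW - CJ)) by lra.
apply: alg; first exact: two_state_balance.
by rewrite (integral_along_curve _ _ _ _ _ tpsi C1X C1W) W0 mul0r oppr0 sub0r.
Qed.

(** * The delta shock waves are solutions *)

(** The two relations express the balance of mass and of generalised momentum on
    the curve; the condition on [A] makes the radicand in [w0] nonnegative. *)
Lemma aw_rascle_rankine_hugoniot (A rho_m u_m rho_p u_p : R) :
  0 < rho_m -> 0 < rho_p -> u_p < u_m -> 0 <= A <= rho_m * (u_m - u_p) ->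
  let w0 := aw_rascle_w0 A rho_m u_m rho_p u_p in
  let v := aw_rascle_v A rho_m u_m rho_p u_p in
  w0 = v * (rho_p - rho_m) - (rho_p * u_p - rho_m * u_m) /\
  w0 * v = v * (rho_p * u_p - rho_m * u_m) -
     (rho_p * u_p ^+ 2 - rho_m * u_m ^+ 2) + A * (u_p - u_m).
Proof.
move=> rm0 rp0 u_lt /andP[A0 Ale] /=; rewrite /aw_rascle_v /aw_rascle_w0.
have rmN : rho_m != 0 by rewrite gt_eqF.
have rpN : rho_p != 0 by rewrite gt_eqF.
case: ifPn => [/eqP ->|rN]; first by split; field.
have drN : rho_p - rho_m != 0 by rewrite subr_eq0.
set r := _ * (_ - _) * _; set w := Num.sqrt r.
have w2 : w ^+ 2 = r.
  rewrite sqr_sqrtr// /r mulr_le0//.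
    by rewrite mulr_ge0_le0// ?mulr_ge0 ?ltW// subr_lt0.
  have : A / rho_m <= u_m - u_p by rewrite ler_pdivrMr// mulrC.
  have : 0 <= A / rho_p by rewrite divr_ge0// ltW.
  by lra.
split; first by field.
have rE : r =
    rho_p * rho_m * (u_p - u_m) ^+ 2 + A * (u_p - u_m) * (rho_p - rho_m).
  by rewrite /r; field; rewrite rmN.
(* Multiplied by [rho_p - rho_m], the second relation reads [w ^+ 2 = r]. *)
apply: (mulIf drN); apply/eqP; rewrite -subr_eq0; apply/eqP.
transitivity (w ^+ 2 - r); last by rewrite w2 subrr.
by rewrite rE; field.
Qed.

Lemma measurable_velocity (d : @delta_wave R) :
  continuous (position d) -> continuous (speed d) ->
  measurable_fun setT (velocity d).
Proof.
move=> cX cs; have mX := continuous_measurable_fun cX.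
have ms := continuous_measurable_fun cs.
apply: measurable_fun_ifT.
- by apply: measurable_fun_ltr => //; exact: measurableT_comp.
- by apply: measurable_funD => //; exact: measurable_funM.
apply: measurable_fun_ifT.
- by apply: measurable_fun_eqr => //; exact: measurableT_comp.
- exact: measurableT_comp.
- by apply: measurable_funD => //; exact: measurable_funM.
Qed.

Lemma measurable_pressure (A : R) (d : @delta_wave R) :
  continuous (position d) -> measurable_fun setT (pressure A d).
Proof.
move=> cX; have mX := continuous_measurable_fun cX.
have -> : pressure A d = fun p => if p.1 == position d p.2 then 0 else
    if p.1 < position d p.2 then - (A / left_density d)
    else - (A / right_density d).
  apply/funext => p; rewrite /pressure /regular_density.
  by case: ifP => // _; case: ifP.
apply: measurable_fun_ifT => //.
  by apply: measurable_fun_eqr => //; exact: measurableT_comp.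
apply: measurable_fun_ifT => //.
by apply: measurable_fun_ltr => //; exact: measurableT_comp.
Qed.

Definition parabola (beta v t : R) : R := v * t + 2^-1 * beta * t ^+ 2.

Lemma C1_parabola (beta v : R) : C1 (parabola beta v) (fun t => v + beta * t).
Proof.
split; first exact: continuous_affine.
by move=> t; apply: is_derive_eq; rewrite /GRing.scale/=; field.
Qed.

(** The range of [A] includes [0], which is the transport case. *)
Lemma aw_rascle_delta_shock_solution (beta A rho_m u_m rho_p u_p : R) :
  0 < rho_m -> 0 < rho_p -> u_p < u_m -> 0 <= A <= rho_m * (u_m - u_p) ->
  aw_rascle_solution beta A rho_m u_m rho_p u_p
    (aw_rascle_delta_shock beta A rho_m u_m rho_p u_p).
Proof.
move=> rm0 rp0 u_lt A0.
have [RH1 RH2] := aw_rascle_rankine_hugoniot _ _ _ _ _ rm0 rp0 u_lt A0.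
have rmN : rho_m != 0 by rewrite gt_eqF.
have rpN : rho_p != 0 by rewrite gt_eqF.
rewrite /aw_rascle_delta_shock.
set w0 := aw_rascle_w0 _ _ _ _ _ in RH1 RH2 *.
set v := aw_rascle_v _ _ _ _ _ in RH1 RH2 *.
set d := DeltaWave _ _ _ _ _ _ _ _.
pose X := parabola beta v; pose X' t := v + beta * t.
have X0 : X 0 = 0 by rewrite /X /parabola; ring.
have C1X : C1 X X' := C1_parabola beta v.
have cX := C1_continuous _ _ C1X.
have mvel := measurable_velocity d cX C1X.1.
have mP := measurable_pressure A d cX.
have ccst (r : R) : continuous (cst r : R -> R) by exact: cst_continuous.
have C1cst (r : R) : C1 (cst r) (cst 0).
  by split=> [|t]; [exact: ccst|exact: is_derive_cst].
pose um t := u_m + beta * t; pose up t := u_p + beta * t.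
have cmom (r u : R) : continuous (fun t => r * (u + beta * t)).
  by apply: continuous_mul; [exact: ccst|exact: continuous_affine].
have velE p : p.1 != X p.2 ->
    velocity d p = if p.1 < X p.2 then um p.2 else up p.2.
  by move=> /negbTE pX; rewrite /velocity/= -/(parabola _ _ _) -/X pX.
have velX t : velocity d (X t, t) = X' t.
  by rewrite /velocity/= -/(parabola _ _ _) -/X ltxx eqxx.
have preE p : p.1 != X p.2 ->
    pressure A d p = if p.1 < X p.2 then - (A / rho_m) else - (A / rho_p).
  move=> /negbTE pX; rewrite /pressure/= -/(parabola _ _ _) -/X pX.
  by rewrite /regular_density/= -/(parabola _ _ _) -/X; case: ifP.
have preX t : pressure A d (X t, t) = 0.
  by rewrite /pressure/= -/(parabola _ _ _) -/X eqxx.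
have rhoE p : regular_density d p = if p.1 < X p.2 then rho_m else rho_p by [].
split.
- by split=> // t _; exact: C1X.2.
- apply: (weak_balance_law_two_state d _ _ _ X' (fun t => w0 * t) (cst w0)
    (cst rho_m) (cst rho_p) (cst 0) (cst 0)
    (fun t => rho_m * um t) (fun t => rho_p * up t)) => //.
  + by rewrite mulr0.
  + split=> // t; apply: is_derive_eq; rewrite /GRing.scale/=; ring.
  + exact: cmom.
  + exact: cmom.
  + by move=> p pX; rewrite rhoE velE// /two_state/=; case: ifP => _; split; ring.
  + move=> t; rewrite velX/=; split; [ring|by []|].
    by rewrite mulr0 RH1 /X' /um /up; ring.
- have -> : rho_m * (u_m - A / rho_m) = rho_m * um 0 - A by rewrite /um; field.
  have -> : rho_p * (u_p - A / rho_p) = rho_p * up 0 - A by rewrite /up; field.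
  have C1mom (r u : R) : C1 (fun t => r * (u + beta * t) - A) (cst (r * beta)).
    by split=> // t; apply: is_derive_eq; rewrite /GRing.scale/=; ring.
  apply: (weak_balance_law_two_state d _ _ _ X' (fun t => w0 * t * X' t)
    (fun t => w0 * v + (2 * w0 * beta) * t)
    (fun t => rho_m * um t - A) (fun t => rho_p * up t - A)
    (cst (rho_m * beta)) (cst (rho_p * beta))
    (fun t => (rho_m * um t - A) * um t) (fun t => (rho_p * up t - A) * up t))
    => //.
  + by rewrite mulr0 mul0r.
  + split=> [|t]; first exact: continuous_affine.
    by apply: is_derive_eq; rewrite /X' /GRing.scale/=; ring.
  + exact: C1mom.
  + exact: C1mom.
  + apply: continuous_mul; last exact: continuous_affine.
    exact: (C1_continuous _ _ (C1mom _ _)).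
  + apply: continuous_mul; last exact: continuous_affine.
    exact: (C1_continuous _ _ (C1mom _ _)).
  + exact: measurable_funD.
  + by apply: measurable_funM => //; exact: measurable_funD.
  + move=> p pX; rewrite rhoE /= velE// preE// /two_state/=.
    by case: ifP => _; split; field.
  + move=> t; rewrite /= velX preX addr0 /=; split => //; first by ring.
    by rewrite RH2 RH1 /X' /um /up; ring.
Qed.

(** With [a = sqrt rho_m] and [b = sqrt rho_p], both the numerator of [v] and
    the difference of the densities have the factor [b - a], which cancels. *)
Lemma aw_rascle_delta_shock0 (beta rho_m u_m rho_p u_p : R) :
  0 < rho_m -> 0 < rho_p -> u_p < u_m ->
  aw_rascle_delta_shock beta 0 rho_m u_m rho_p u_p
  = transport_delta_shock beta rho_m u_m rho_p u_p.
Proof.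
move=> rm0 rp0 u_lt.
have w0E : aw_rascle_w0 0 rho_m u_m rho_p u_p = transport_w0 rho_m u_m rho_p u_p.
  rewrite /aw_rascle_w0 /transport_w0; case: ifP => [/eqP ->|_]; first by ring.
  rewrite !mul0r !subr0 -mulrA -expr2 sqrtrM ?mulr_ge0 ?ltW//.
  by rewrite sqrtr_sqr distrC gtr0_norm// subr_gt0.
have vE : aw_rascle_v 0 rho_m u_m rho_p u_p = transport_sigma rho_m u_m rho_p u_p.
  rewrite /aw_rascle_v /transport_sigma w0E /transport_w0.
  case: ifPn => [_|rN]; first by rewrite mul0r subr0.
  rewrite (negbTE rN) sqrtrM ?ltW//.
  have rmE : rho_m = Num.sqrt rho_m ^+ 2 by rewrite sqr_sqrtr// ltW.
  have rpE : rho_p = Num.sqrt rho_p ^+ 2 by rewrite sqr_sqrtr// ltW.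
  have a0 : 0 < Num.sqrt rho_m by rewrite sqrtr_gt0.
  have b0 : 0 < Num.sqrt rho_p by rewrite sqrtr_gt0.
  rewrite -subr_eq0 in rN.
  set a := Num.sqrt rho_m in rmE a0 *; set b := Num.sqrt rho_p in rpE b0 *.
  rewrite rmE rpE in rN *.
  by field; rewrite rN gt_eqF// addr_gt0.
by rewrite /aw_rascle_delta_shock /transport_delta_shock w0E vE.
Qed.

Lemma transport_delta_shock_solution (beta rho_m u_m rho_p u_p : R) :
  0 < rho_m -> 0 < rho_p -> u_p < u_m ->
  transport_solution beta rho_m u_m rho_p u_p
    (transport_delta_shock beta rho_m u_m rho_p u_p).
Proof.
move=> rm0 rp0 u_lt.
have := aw_rascle_delta_shock_solution beta 0 _ _ _ _ rm0 rp0 u_lt.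
rewrite lexx mulr_ge0 ?subr_ge0 ?ltW// aw_rascle_delta_shock0// => /(_ isT).
set d := transport_delta_shock _ _ _ _ _.
have P0 : velocity d \+ pressure 0 d = velocity d.
  by apply/funext => p; rewrite /= /pressure mul0r oppr0 if_same addr0.
by rewrite /aw_rascle_solution P0 !mul0r !subr0.
Qed.

(** * Vanishing pressure *)

(** Before the shear the integrand is discontinuous in [v] on the curve; after
    it only the continuous factor [g] moves, and for [v] in a bounded interval all
    the supports lie in one rectangle. *)
Lemma continuous_integral_two_state a b c g :
  continuous a -> continuous b -> continuous c -> Cc g ->
  continuous
    (fun v : R => integral_st (two_state (fun t => v * t + c t) a b \* g)).
Proof.
move=> ca cb cc Cg v0.
have cX (v : R) : continuous (fun t => v * t + c t).
  by move=> t; apply: cvgD; [apply: cvgM; [exact: cvg_cst|exact: cvg_id]|exact: cc].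
have [cg [M sM]] := Cg.
pose S := two_state (cst 0) a b.
pose F (v : R) (p : R * R) : R := S p * g (shear (fun t => v * t + c t) p).
have -> : (fun v => integral_st (two_state (fun t => v * t + c t) a b \* g)) =
    (fun v => \int[mu2]_(p in space_time) F v p).
  by apply/funext => v; rewrite integral_two_state_shear.
have iF v : mu2.-integrable space_time (EFin \o F v).
  apply: (@integrableS _ _ _ mu2 setT) => //; first exact: measurable_space_time.
  by apply: integrable_two_state => //; [exact: cst_continuous|exact: Cc_shear].
have [L gL] := Cc_bounded _ Cg.
have [C cC] := continuous_bounded_itv c M cc.
(* For [v] within 1 of [v0] and [t] at most [M], [C] bounding [c], the point
   [v * t + c t] is at distance at most [(`|v0| + 1) * M + C] from the origin. *)
pose M' := Num.max M (M + ((`|v0| + 1) * M + C)).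
have [K SK] := locally_bounded_two_state (cst 0) a b ca cb M'.
pose G (p : R * R) : R :=
  if (`|p.1| <= M') && (`|p.2| <= M) then K * L else 0.
have iG : mu2.-integrable space_time (EFin \o G).
  apply: (@integrableS _ _ _ mu2 setT) => //; first exact: measurable_space_time.
  apply: integrable_bounded_support.
  - by apply: measurable_fun_ifT => //; apply: measurable_and;
      apply: measurable_fun_ler => //; apply: measurableT_comp.
  - move=> N; exists `|K * L| => p _ _; rewrite /G; case: ifP => // _.
    by rewrite normr0.
  - exists M' => p pM; rewrite /G ifF//; apply/negbTE; rewrite negb_and -!ltNge.
    case: pM => [->//|pM]; rewrite (le_lt_trans _ pM) ?orbT//.
    by rewrite /M' le_max lexx.
apply: (@continuity_under_integral R _ plane mu2 F space_time
  measurable_space_time (v0 - 1) (v0 + 1) (fun v _ => iF v) _ G iG _ v0 _).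
- apply: aeW => p _ v _; apply: cvgM; first exact: cvg_cst.
  have cs : {for v, continuous (fun v : R => p.1 + (v * p.2 + c p.2))}.
    apply: cvgD; first exact: cvg_cst.
    by apply: cvgD; [apply: cvgM; [exact: cvg_id|exact: cvg_cst]|exact: cvg_cst].
  have csh : {for v, continuous (fun v : R => shear (fun t => v * t + c t) p)}.
    exact: (cvg_pair cs (cvg_cst p.2)).
  exact: (continuous_comp csh (cg _)).
- move=> v /= vI; apply: aeW => p _; rewrite /F /G.
  have [pS|pS] := boolP (_ && _).
    case/andP: pS => p1 p2; rewrite normrM ler_pM// SK//.
    by rewrite (le_trans p2)// /M' le_max lexx.
  rewrite sM ?mulr0 ?normr0//; rewrite /shear/=.
  move: pS; rewrite negb_and -!ltNge.
  have [p2|p2] := ltP M `|p.2|; first by right.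
  rewrite orbF gt_max => /andP[_ p1]; left; have cp := cC _ p2.
  have vp : `|v * p.2| <= (`|v0| + 1) * M.
    rewrite normrM ler_pM//; move: vI; rewrite in_itv/= -ltr_distlC => vv0.
    by have := lerB_dist v v0; rewrite distrC in vv0; lra.
  have := lerB_dist p.1 (- (v * p.2 + c p.2)); rewrite opprK normrN => h.
  by have := ler_normD (v * p.2) (c p.2); lra.
- by rewrite inE/= in_itv/= ltrBlDr ltrDl ltr01.
Qed.

(** The Dirac part is turned into a bulk integral so that its continuity in [v]
    is an instance of [continuous_integral_two_state]. *)
Lemma density_integral_parabola (beta rho_m u_m rho_p u_p v w0 : R) psi :
  test_function psi ->
  density_integral (DeltaWave beta rho_m u_m rho_p u_p (parabola beta v)
    (fun t => w0 * t) (fun t => v + beta * t)) psi =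
  integral_st (two_state (parabola beta v) (cst rho_m) (cst rho_p) \* psi)
  + w0 * integral_st (two_state (parabola beta v) id (cst 0) \* dx psi).
Proof.
move=> tpsi; rewrite /density_integral; congr (_ + _).
have C1X := C1_parabola beta v; have cX := C1_continuous _ _ C1X.
have [Cpsi Cdx _] := Cc_test_function psi tpsi.
have c0 : continuous (cst 0 : R -> R) by exact: cst_continuous.
have cid : continuous (@id R) by exact: continuous_id.
rewrite (integral_two_state_shear _ _ _ _ cX cid c0 Cdx).
rewrite (integral_jump_dx _ _ _ (C1c_shear _ _ _ tpsi C1X) _ _ cid c0).
have E : (fun t => (id t - cst 0 t) * (psi \o shear (parabola beta v)) (0, t))
    = (fun t => id t * psi (parabola beta v t, t)).
  by apply/funext => t; rewrite /shear/= subr0 add0r.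
rewrite E -(RintegralZl w0 measurable_halfline
  (integrable_along _ _ _ cid cX Cpsi)).
by apply: eq_Rintegral => t _ /=; rewrite mulrA.
Qed.

Lemma velocity_integral_parabola (beta rho_m u_m rho_p u_p v w0 : R) psi :
  test_function psi ->
  velocity_integral (DeltaWave beta rho_m u_m rho_p u_p (parabola beta v)
    (fun t => w0 * t) (fun t => v + beta * t)) psi =
  integral_st (two_state (parabola beta v)
    (fun t => u_m + beta * t) (fun t => u_p + beta * t) \* psi).
Proof.
move=> tpsi; set d := DeltaWave _ _ _ _ _ _ _ _.
have cX := C1_continuous _ _ (C1_parabola beta v).
have [[cpsi _] _ _] := Cc_test_function psi tpsi.
have mpsi := continuous_measurable_prod psi cpsi.
have caff (u : R) := continuous_affine u beta.
apply: (integral_st_eq_off_curve _ _ _ (continuous_measurable_fun cX)).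
- by apply: measurable_funM => //; exact: (measurable_velocity d cX (caff v)).
- by apply: measurable_funM => //; exact: measurable_two_state.
by move=> p /negbTE pX; rewrite /= /velocity/= pX.
Qed.

Lemma aw_rascle_continuous (rho_m u_m rho_p u_p : R) :
  continuous (fun A => aw_rascle_w0 A rho_m u_m rho_p u_p) /\
  continuous (fun A => aw_rascle_v A rho_m u_m rho_p u_p).
Proof.
have cw : continuous (fun A => aw_rascle_w0 A rho_m u_m rho_p u_p).
  rewrite /aw_rascle_w0; case: (rho_p == rho_m); first by move=> A; exact: cvg_cst.
  move=> A; pose r A := rho_p * rho_m * (u_p - u_m) *
    (u_p - u_m - (A / rho_p - A / rho_m)).
  apply: (@continuous_comp _ _ _ r Num.sqrt); last exact: sqrt_continuous.
  apply: cvgM; first exact: cvg_cst.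
  apply: cvgB; first exact: cvg_cst.
  by apply: cvgB; apply: cvgM;
    [exact: cvg_id|exact: cvg_cst|exact: cvg_id|exact: cvg_cst].
split=> //; rewrite /aw_rascle_v; case: (rho_p == rho_m) => A.
- apply: cvgM; first exact: cvg_cst.
  apply: cvgB; first exact: cvg_cst.
  by apply: cvgM; [exact: cvg_id|exact: cvg_cst].
- apply: cvgM; last exact: cvg_cst.
  by apply: cvgD; [exact: cvg_cst|exact: cw].
Qed.

Lemma aw_rascle_delta_shock_cvg (beta rho_m u_m rho_p u_p : R) :
  delta_wave_cvg (fun A => aw_rascle_delta_shock beta A rho_m u_m rho_p u_p)
    0^'+ (aw_rascle_delta_shock beta 0 rho_m u_m rho_p u_p).
Proof.
pose v A := aw_rascle_v A rho_m u_m rho_p u_p.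
have [cw cv] := aw_rascle_continuous rho_m u_m rho_p u_p.
have ccst (r : R) : continuous (cst r : R -> R) by exact: cst_continuous.
have cc : continuous (fun t : R => 2^-1 * beta * t ^+ 2).
  move=> t; apply: cvgM; first exact: cvg_cst.
  by apply: cvgM; exact: cvg_id.
have cI (a b : R -> R) (g : R * R -> R) : continuous a -> continuous b -> Cc g ->
    continuous (fun A => integral_st (two_state (parabola beta (v A)) a b \* g)).
  move=> ca cb Cg A.
  pose I u := integral_st (two_state (parabola beta u) a b \* g).
  apply: (@continuous_comp _ _ _ v I); first exact: cv.
  exact: (continuous_integral_two_state _ _ _ _ ca cb cc Cg).
have right_cvg (h : R -> R) : continuous h -> h A @[A --> 0^'+] --> h 0.
  by move=> ch; apply: cvg_at_right_filter; exact: ch.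
split.
- move=> psi tpsi; have [Cpsi Cdx _] := Cc_test_function psi tpsi.
  apply: right_cvg; under eq_fun do rewrite density_integral_parabola//.
  move=> A; apply: cvgD; first exact: cI.
  by apply: cvgM; [exact: cw|apply: cI => //; exact: continuous_id].
- move=> psi tpsi; have [Cpsi _ _] := Cc_test_function psi tpsi.
  apply: right_cvg; under eq_fun do rewrite velocity_integral_parabola//.
  by apply: cI => //; exact: continuous_affine.
- move=> t _; split; apply: right_cvg => A.
  + by apply: cvgD; [apply: cvgM; [exact: cv|exact: cvg_cst]|exact: cvg_cst].
  + by apply: cvgM; [exact: cw|exact: cvg_cst].
  + by apply: cvgD; [exact: cv|exact: cvg_cst].
Qed.

End Lebesgue.

Theorem theorem4p2 (R : realType) (beta rho_m rho_p u_m u_p : R)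
    (rho_m_gt0 : 0 < rho_m) (rho_p_gt0 : 0 < rho_p)
    (u_m_ge0 : 0 <= u_m) (u_p_ge0 : 0 <= u_p) (u_p_lt_u_m : u_p < u_m) :
  let A0 := rho_m * (u_m - u_p) in
  let AR := fun A : R => aw_rascle_delta_shock beta A rho_m u_m rho_p u_p in
  let TR := transport_delta_shock beta rho_m u_m rho_p u_p in
  [/\ forall A : R, 0 < A < A0 -> region_III A rho_m u_m (rho_p, u_p),
      forall A : R, 0 < A < A0 ->
        aw_rascle_solution beta A rho_m u_m rho_p u_p (AR A),
      transport_solution beta rho_m u_m rho_p u_p TR
    & delta_wave_cvg AR 0^'+ TR].
Proof.
move=> A0 AR TR; split.
- move=> A /andP[_ /ltW AA0]; rewrite /region_III/= lerBrDr -lerBrDl.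
  by rewrite ler_pdivrMr// mulrC.
- move=> A /andP[/ltW A_ge0 /ltW AA0]; apply: aw_rascle_delta_shock_solution => //.
  by rewrite A_ge0.
- exact: transport_delta_shock_solution.
- rewrite /TR -aw_rascle_delta_shock0//; exact: aw_rascle_delta_shock_cvg.
Qed.
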